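(* Let $\mathcal G = (g_i)_{i=0}^{\infty}$ be a $\mathcal G$-adic sequence with bounded quotients, that is, there is an integer $d \geq 2$ such that $d_i = g_{i+1}/g_i \leq d$ for all $i = 0,1,2,\ldots$. Let $I$ be a set of nonnegative integers, and, for each $i \in I$, let $U_i$ be a nonempty proper subset of $[0,d_i-1]$. Let $A$ be the set of positive integers $n$ whose $\mathcal G$-adic representation $n = \sum_{i=0}^k c_i g_i$ (with $c_k \neq 0$) satisfies the missing digits condition $$c_i \in [0,d_i-1] \setminus U_i \quad \text{for all } i \in I \cap [0,k].$$ (1) If there exist $\delta > 0$ and $k_0 = k_0(\delta)$ such that $$I(k) \geq \frac{(1+\delta)\log k}{\log (d/(d-1))} \quad \text{for all integers } k \geq k_0,$$ then the set $A$ has asymptotic density zero and the harmonic series $\sum_{a\in A} 1/a$ converges. (2) If there exist $\delta > 0$ and $k_1 = k_1(\delta)$ such that $$I(k) \leq \frac{(1-\delta)\log k}{\log d} \quad \text{for all integers } k \geq k_1,$$ then the harmonic series $\sum_{a\in A} 1/a$ diverges.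
   Context: A $\mathcal G$-adic sequence is a strictly increasing sequence of positive integers $\mathcal G = (g_i)_{i=0}^{\infty}$ such that $g_0 = 1$ and $g_i$ divides $g_{i+1}$ for all $i \geq 0$. Its quotients are the integers $d_i = g_{i+1}/g_i \geq 2$. Every positive integer $n$ has a unique representation $n = \sum_{i=0}^{k} c_i g_i$ with $c_i \in \{0,1,\ldots,d_i-1\}$ for all $i \in \{0,1,\ldots,k\}$ and $c_k \neq 0$; this is called the $\mathcal G$-adic representation of $n$ (here $k$ is determined by $g_k \leq n \leq g_{k+1}-1$). For integers $a,b$, $[a,b] = \{n \in \mathbf Z : a \leq n \leq b\}$ denotes the interval of integers. For a set $X$ of nonnegative integers, $X(n)$ denotes the number of elements $x \in X$ with $x \leq n$; in particular $I(k) = |I \cap [0,k]|$. The set $X$ has asymptotic density zero if $\lim_{n\to\infty} X(n)/n = 0$. The thresholds $k_0, k_1$ are understood to be positive integers, so that $\log k$ is defined. *)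

(* Defs.v *)
From HB Require Import structures.
From mathcomp Require Export all_boot all_order all_algebra.
From mathcomp Require Export all_classical all_reals all_analysis.
Export Order.TTheory GRing.Theory Num.Theory numFieldNormedType.Exports.

Set Implicit Arguments.
Unset Strict Implicit.
Unset Printing Implicit Defensive.

Local Open Scope classical_set_scope.
Local Open Scope ring_scope.

Definition adic_sequence (g : nat -> nat) : Prop :=
  [/\ forall i, (0 < g i)%N,
      forall i, (g i < g i.+1)%N,
      g 0%N = 1%N &
      forall i, (g i %| g i.+1)%N].

(* The division is exact when g is an adic sequence. *)
Definition adic_quotient (g : nat -> nat) (i : nat) : nat := (g i.+1 %/ g i)%N.

(* Only the values c 0, ..., c k matter. *)
Definition adic_representation (g : nat -> nat) (n k : nat) (c : nat -> nat) :
    Prop :=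
  [/\ forall i, (i <= k)%N -> `I_(adic_quotient g i) (c i),
      c k <> 0%N &
      n = (\sum_(i < k.+1) c i * g i)%N].

(* For an adic sequence g every n > 0 has exactly one representation, so the
   existential quantifier picks out the representation of n. *)
Definition missing_digits_set (g : nat -> nat) (I : set nat)
    (U : nat -> set nat) : set nat :=
  [set n | (0 < n)%N /\
     exists k c, adic_representation g n k c /\
       forall i, I i -> (i <= k)%N -> (`I_(adic_quotient g i) `\` U i) (c i)].

(* X(n) = #{x in X : x <= n}; the element 0 is counted. *)
Definition counting_function (X : set nat) (n : nat) : nat :=
  #|[set x : 'I_n.+1 | (x : nat) \in X]%SET|.

Definition asymptotic_density_zero (R : realType) (X : set nat) : Prop :=
  ((counting_function X n)%:R / n%:R : R) @[n --> \oo] --> (0 : R).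

(* Partial sums of sum_(x in X) 1/x in increasing order of x; since 0^-1 = 0,
   a possible element 0 of X would contribute nothing. *)
Definition harmonic_series_over (R : realType) (X : set nat) : R^nat :=
  [series (if n \in X then n%:R^-1 else 0 : R)]_n.

(* Main.v *)
Require Import Defs.
From mathcomp Require Import zify ring lra.
Set Implicit Arguments.
Unset Strict Implicit.
Unset Printing Implicit Defensive.
Local Open Scope classical_set_scope.
Local Open Scope ring_scope.

(** The harmonic sum over A is cut into the blocks [g_k, g_(k+1)), on which
    1/n is comparable to 1/g_k since g_(k+1) <= d g_k, so that everything
    reduces to counting the elements of A in a block.

    Let B_k be the set of the n < g_k all of whose k digits, leading zeros
    included, are admissible. Then |B_k| is the product over i < k of the number
    of admissible digits at place i. At a place of I that number lies between 1
    and d_i - 1, hence between d_i / d and d_i (1 - 1/d); elsewhere it is d_i.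
    Since g_k is the product of the d_i, with J = |I cap [0, k-1]| this gives
      g_k / d^J <= |B_k| <= g_k ((d-1)/d)^J
    ([size_admissible_numbers_bounds]).

    Convergence: A cap [g_k, g_(k+1)) lies in B_(k+1), so its harmonic sum is at
    most d ((d-1)/d)^I(k) ([block_sum_le]). The hypothesis on I(k) says exactly
    that this is at most d k^-(1+delta) for large k, and a telescoping
    comparison ([expR_ln_telescope]) bounds the sum over k. Density zero then
    holds for any set whose harmonic series converges
    ([harmonic_cvg_density_zero]).

    Divergence: if k is not in I then A contains g_k + B_k, which lies in
    [g_k, 2 g_k), so block k contributes at least 1/(2 d^I(k))
    ([block_sum_ge]). The hypothesis gives d^I(k) <= k for large k. It makes that
    contribution at least 1/(2k), and it also makes I so sparse that at least half
    of the k in [M, 2M) avoid it when M is a large power of 2. Hence the blocks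
    from M to 2M - 1 contribute at least 1/8, against the Cauchy criterion. *)

(** * Numbers below g_k with admissible digits *)

Definition admissible_digits (g : nat -> nat) (I : set nat)
    (U : nat -> set nat) (k : nat) : seq nat :=
  [seq c <- iota 0 (adic_quotient g k) | ~~ `[< I k /\ U k c >]].

(** Leading zeros are subject to the digit condition here, unlike in A: this is
    what makes the size an exact product. Listing the numbers rather than testing
    digits avoids defining the digits of a number. *)
Fixpoint admissible_numbers (g : nat -> nat) (I : set nat)
    (U : nat -> set nat) (k : nat) : seq nat :=
  if k is j.+1 then
    [seq (c * g j + b)%N | c <- admissible_digits g I U j,
                           b <- admissible_numbers g I U j]
  else [:: 0%N].

Lemma adic_quotientM (g : nat -> nat) k :
  adic_sequence g -> (adic_quotient g k * g k)%N = g k.+1.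
Proof. by case=> _ _ _ dvd; rewrite /adic_quotient divnK. Qed.

Lemma adic_quotient_gt1 (g : nat -> nat) k :
  adic_sequence g -> (1 < adic_quotient g k)%N.
Proof.
move=> hg; have := adic_quotientM k hg; case: hg => /(_ k) + /(_ k) + _ _.
nia.
Qed.

Lemma leq_adic (g : nat -> nat) i j :
  adic_sequence g -> (i <= j)%N -> (g i <= g j)%N.
Proof.
by case=> _ inc _ _; apply: (homo_leq leqnn leq_trans) => k; exact/ltnW/inc.
Qed.

Lemma adic_ge_index (g : nat -> nat) n : adic_sequence g -> (n <= g n)%N.
Proof.
case=> _ inc _ _; elim: n => // n IH; exact: leq_ltn_trans IH (inc n).
Qed.

Lemma mem_admissible_digits g I U k c :
  reflect ((c < adic_quotient g k)%N /\ (I k -> ~ U k c))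
          (c \in admissible_digits g I U k).
Proof.
rewrite mem_filter mem_iota add0n leq0n /=.
apply: (iffP andP) => [[/asboolPn nIU ->]|[-> nIU]]; split=> //.
  by move=> Ik Uc; apply: nIU.
by apply/asboolPn => -[/nIU].
Qed.

Lemma admissible_numbers_sum g I U k (c : nat -> nat) :
  (forall i, (i < k)%N -> c i \in admissible_digits g I U i) ->
  (\sum_(i < k) c i * g i)%N \in admissible_numbers g I U k.
Proof.
elim: k => [|k IH] hc; first by rewrite big_ord0.
rewrite big_ord_recr /= addnC; apply: allpairs_f; first exact: hc.
by apply: IH => i ik; apply: hc; rewrite ltnS ltnW.
Qed.

Lemma admissible_numbers_digits g I U k b :
  b \in admissible_numbers g I U k ->
  exists2 c : nat -> nat,
    forall i, (i < k)%N -> c i \in admissible_digits g I U i &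
    b = (\sum_(i < k) c i * g i)%N.
Proof.
elim: k b => [|k IH] b /=.
  by rewrite inE => /eqP->; exists (fun=> 0%N) => //; rewrite big_ord0.
case/allpairsP => -[x y] /= [xD /IH[c cD ->] ->].
exists (fun i => if i == k then x else c i) => [i|].
  by rewrite ltnS leq_eqVlt; case: eqVneq => [->//|_] /=; exact: cD.
rewrite big_ord_recr /= eqxx addnC; congr addn.
by apply: eq_bigr => i _; rewrite ltn_eqF.
Qed.

Lemma admissible_numbers_lt g I U k b : adic_sequence g ->
  b \in admissible_numbers g I U k -> (b < g k)%N.
Proof.
move=> hg; elim: k b => [|k IH] b /=.
  by case: (hg) => _ _ -> _; rewrite inE => /eqP->.
case/allpairsP => -[x y] /= [/mem_admissible_digits[xq _] /IH yg ->].
rewrite -(adic_quotientM k hg); nia.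
Qed.

(** Uniqueness of the representation: the last digit and the rest of
    [c * g k + b] are its quotient and its remainder modulo [g k]. *)
Lemma admissible_numbers_uniq g I U k : adic_sequence g ->
  uniq (admissible_numbers g I U k).
Proof.
move=> hg; elim: k => //= k IH; apply: allpairs_uniq => //.
  exact/filter_uniq/iota_uniq.
have gk : (0 < g k)%N by case: hg.
move=> _ _ /allpairsP[[x y] [_ yB ->]] /allpairsP[[x' y'] [_ y'B ->]] /= e.
have lt1 := admissible_numbers_lt hg yB.
have lt2 := admissible_numbers_lt hg y'B; move: e lt1 lt2 => /= e lt1 lt2.
have := congr1 (modn^~ (g k)) e; have := congr1 (divn^~ (g k)) e.
by rewrite /= !modnMDl !divnMDl // !modn_small // !divn_small // !addn0 => -> ->.
Qed.

(** The length of the representation of n is forced by the block that contains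
    n, so the representation given by membership in A has its leading digit at
    place k. *)
Lemma missing_digits_admissible g I U n k : adic_sequence g ->
  missing_digits_set g I U n -> (g k <= n < g k.+1)%N ->
  n \in admissible_numbers g I U k.+1.
Proof.
move=> hg [_ [j [c [[cq cj nE] cU]]]] /andP[gkn ngk].
have nB : n \in admissible_numbers g I U j.+1.
  rewrite nE; apply: admissible_numbers_sum => i; rewrite ltnS => ij.
  apply/mem_admissible_digits; split; first exact: cq.
  by move=> Ii; case: (cU i Ii ij).
have gjn : (g j <= n)%N by rewrite nE big_ord_recr /=; nia.
have ngj := admissible_numbers_lt hg nB.
suff kj : k = j by rewrite kj; exact: nB.
case: (ltngtP k j) => // /(leq_adic hg); rewrite leqNgt.
  by rewrite (leq_ltn_trans gjn).
by rewrite (leq_ltn_trans gkn).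
Qed.

(** A leading digit 1 is always legitimate at an unconstrained place k, whatever
    zeros follow it. Restricting to such k removes the interaction between [U k]
    and the requirement that the leading digit be nonzero. *)
Lemma admissible_missing_digits g I U k b : adic_sequence g -> ~ I k ->
  b \in admissible_numbers g I U k -> missing_digits_set g I U (g k + b)%N.
Proof.
move=> hg nIk /admissible_numbers_digits[c cD bE].
pose c' i := if i == k then 1%N else c i.
have c'D i : (i <= k)%N -> c' i \in admissible_digits g I U i.
  rewrite /c' leq_eqVlt; case: eqVneq => [-> _|_] /=; last exact: cD.
  by apply/mem_admissible_digits; split=> //; exact: adic_quotient_gt1.
split; first by case: hg => /(_ k) + _ _ _; lia.
exists k, c'; split=> [|i Ii ik]; last first.
  by case/mem_admissible_digits: (c'D i ik) => ? /(_ Ii).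
split=> [i /c'D/mem_admissible_digits[]//||]; first by rewrite /c' eqxx.
rewrite big_ord_recr /= {2}/c' eqxx mul1n addnC bE; congr addn.
by apply: eq_bigr => i _; rewrite /c' ltn_eqF.
Qed.

(** * Counting admissible numbers *)

Definition constrained_below (I : set nat) (k : nat) : nat :=
  (\sum_(0 <= i < k) (i \in I))%N.

Lemma counting_functionE (I : set nat) k :
  counting_function I k = constrained_below I k.+1.
Proof.
rewrite /counting_function /constrained_below cardsE -sum1_card big_mkord.
by rewrite big_mkcond; apply: eq_bigr => i _; rewrite unfold_in /=.
Qed.

(** At a constrained place, with q <= d the quotient and 1 <= s <= q - 1 the
    number of admissible digits, q <= d <= s d, and s d <= (q - 1) d <= (d - 1) q.
    The exponent is the truth value of [k \in I], which makes the bounds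
    multiply along k. *)
Lemma size_admissible_digits_bounds (g : nat -> nat) (I : set nat) U d k :
  adic_sequence g ->
  (adic_quotient g k <= d)%N ->
  (I k -> U k !=set0 /\ U k `<` `I_(adic_quotient g k)) ->
  (adic_quotient g k <= size (admissible_digits g I U k) * d ^ (k \in I) /\
   size (admissible_digits g I U k) * d ^ (k \in I)
     <= d.-1 ^ (k \in I) * adic_quotient g k)%N.
Proof.
move=> hg qd hU; case: (boolP (k \in I)) => [|/negP] kI.
  have Ik : I k by apply/set_mem.
  have [[u Uu] [sU nU]] := hU Ik.
  have [v [vq nUv]] : exists v, (v < adic_quotient g k)%N /\ ~ U k v.
    by apply: contra_notP nU => h v vq; apply: contrapT => nUv; apply: h; exists v.
  have s0 : (0 < size (admissible_digits g I U k))%N.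
    rewrite lt0n size_eq0; apply/eqP => s0.
    have : v \in admissible_digits g I U k by apply/mem_admissible_digits.
    by rewrite s0.
  have s1 : (size (admissible_digits g I U k) < adic_quotient g k)%N.
    rewrite -[X in (_ < X)%N](size_iota 0) size_filter ltn_neqAle count_size andbT.
    rewrite -all_count; apply/allPn; exists u.
      by rewrite mem_iota add0n /=; exact: sU.
    by rewrite negbK; apply/asboolP.
  by rewrite !expn1; split; nia.
have -> : admissible_digits g I U k = iota 0 (adic_quotient g k).
  by apply/all_filterP/allP => c _; apply/asboolPn => -[Ik _]; apply/kI/mem_set.
by rewrite !expn0 size_iota muln1 mul1n.
Qed.

Lemma size_admissible_numbers_bounds (g : nat -> nat) (I : set nat) U d k :
  adic_sequence g ->
  (forall i, (adic_quotient g i <= d)%N) ->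
  (forall i, I i -> U i !=set0 /\ U i `<` `I_(adic_quotient g i)) ->
  (g k <= size (admissible_numbers g I U k) * d ^ constrained_below I k /\
   size (admissible_numbers g I U k) * d ^ constrained_below I k
     <= d.-1 ^ constrained_below I k * g k)%N.
Proof.
move=> hg qd hU; elim: k => [|k [IHl IHu]] /=.
  have -> : constrained_below I 0 = 0%N by rewrite /constrained_below big_geq.
  by rewrite !expn0 muln1 mul1n; case: hg => _ _ -> _; split.
have [lo up] := size_admissible_digits_bounds hg (qd k) (hU k).
rewrite size_allpairs -(adic_quotientM k hg).
rewrite /constrained_below big_nat_recr //= -/(constrained_below I k).
rewrite !(addnC (constrained_below I k)) !expnD mulnACA.
split; first exact: leq_mul.
by rewrite [leqRHS]mulnACA leq_mul.
Qed.

(** * Sums of reciprocals *)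

Definition reciprocal_on (R : realType) (X : set nat) (n : nat) : R :=
  if n \in X then n%:R^-1 else 0.

Lemma reciprocal_on_ge0 (R : realType) (X : set nat) n :
  0 <= reciprocal_on R X n.
Proof. by rewrite /reciprocal_on; case: ifP. Qed.

Lemma reciprocal_sum_le (R : realType) (X : set nat) a b (s : seq nat) :
  (0 < a)%N -> (forall n, (a <= n < b)%N -> X n -> n \in s) ->
  \sum_(a <= n < b) reciprocal_on R X n <= (size s)%:R / a%:R.
Proof.
move=> a0 Xs.
pose r := [seq n <- index_iota a b | n \in X].
have rs : (size r <= size s)%N.
  apply: uniq_leq_size; first exact/filter_uniq/iota_uniq.
  by move=> n; rewrite mem_filter mem_index_iota => /andP[/set_mem Xn /Xs]; apply.
apply: (@le_trans _ _ ((size r)%:R / a%:R)); last first.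
  by rewrite ler_wpM2r ?invr_ge0 // ler_nat.
rewrite /reciprocal_on -big_mkcond -big_filter -/r.
rewrite -sum1_size natr_sum mulr_suml big_seq [leRHS]big_seq; apply: ler_sum => n.
rewrite mem_filter mem_index_iota => /and3P[_ an _].
by rewrite mul1r lef_pV2 ?posrE ?ltr0n ?ler_nat ?(leq_trans a0 an).
Qed.

(** Keeping [m] apart from [b] allows both m = b and the sharper m = b - 1. *)
Lemma reciprocal_sum_ge (R : realType) (X : set nat) a b m (s : seq nat) :
  (0 < a)%N -> (b <= m.+1)%N -> uniq s ->
  (forall n, n \in s -> (a <= n < b)%N /\ X n) ->
  (size s)%:R / m%:R <= \sum_(a <= n < b) reciprocal_on R X n.
Proof.
move=> a0 bm us sX.
pose r := [seq n <- index_iota a b | n \in X].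
have sr : (size s <= size r)%N.
  apply: uniq_leq_size => // n /sX[nab Xn].
  by rewrite mem_filter mem_index_iota nab (mem_set Xn).
apply: (@le_trans _ _ ((size r)%:R / m%:R)).
  by rewrite ler_wpM2r ?invr_ge0 // ler_nat.
rewrite /reciprocal_on -big_mkcond -big_filter -/r.
rewrite -sum1_size natr_sum mulr_suml big_seq [leRHS]big_seq; apply: ler_sum => n.
rewrite mem_filter mem_index_iota => /and3P[_ an nb].
have n0 := leq_trans a0 an; have nm : (n <= m)%N by rewrite -ltnS (leq_trans nb).
by rewrite mul1r lef_pV2 ?posrE ?ltr0n ?ler_nat ?(leq_trans n0 nm).
Qed.

Lemma reciprocal_sum_mono (R : realType) (X : set nat) a b c : (b <= c)%N ->
  \sum_(a <= n < b) reciprocal_on R X n <= \sum_(a <= n < c) reciprocal_on R X n.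
Proof.
move=> bc; case: (leqP a b) => ab; last first.
  by rewrite (big_geq (ltnW ab)); apply: sumr_ge0 => n _; exact: reciprocal_on_ge0.
rewrite [leRHS](big_cat_nat ab bc) /= lerDl.
by apply: sumr_ge0 => n _; exact: reciprocal_on_ge0.
Qed.

Lemma sum_blocks (R : realType) (g : nat -> nat) (u : nat -> R) a b :
  {homo g : i j / (i <= j)%N} -> (a <= b)%N ->
  \sum_(g a <= n < g b) u n = \sum_(a <= k < b) \sum_(g k <= n < g k.+1) u n.
Proof.
move=> mono; elim: b => [|b IH]; first by rewrite leqn0 => /eqP->; rewrite !big_geq.
rewrite leq_eqVlt => /predU1P[->|]; first by rewrite !big_geq.
rewrite ltnS => ab; rewrite big_nat_recr //= -IH //.
by rewrite -big_cat_nat ?mono.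
Qed.

(** Beyond a fixed N, the elements of X up to n each contribute at least 1/n to a
    tail of the series which is at most e/2, so there are at most n e/2 of
    them; the at most N + 1 others are negligible against n. *)
Lemma harmonic_cvg_density_zero (R : realType) (X : set nat) :
  cvgn (harmonic_series_over R X) -> asymptotic_density_zero R X.
Proof.
move=> cv; rewrite /asymptotic_density_zero; apply/cvgrPdist_le => e e0.
(* Two partial sums within e/4 of the limit differ by at most e/2. *)
have e4 : 0 < e / 4 by lra.
have /cvgrPdist_le /(_ _ e4) [N _ HN] := cv.
near=> n; rewrite sub0r normrN ger0_norm ?divr_ge0 //.
have n0 : (0 < n)%N by near: n; exists 1%N.
rewrite ler_pdivrMr ?ltr0n //.
have Nn : (N.+1 <= n.+1)%N by rewrite ltnS; near: n; exists N.
have tail : \sum_(N.+1 <= k < n.+1) reciprocal_on R X k <= e / 2.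
  rewrite -(sub_series_geq _ Nn).
  have /= := HN N.+1 (leqnSn N); have /= := HN n.+1 (leqW Nn).
  rewrite !ler_distl /harmonic_series_over /reciprocal_on.
  lra.
pose s := [seq k <- index_iota N.+1 n.+1 | k \in X].
have cnt : (counting_function X n <= N.+1 + size s)%N.
  rewrite counting_functionE /constrained_below (big_cat_nat (leq0n _) Nn) /=.
  apply: leq_add; last by rewrite size_filter -sum1_count [leqRHS]big_mkcond.
  apply: (@leq_trans (\sum_(0 <= i < N.+1) 1)%N).
    by apply: leq_sum => i _; case: (_ \in _).
  by rewrite sum_nat_const_nat muln1 subn0.
have ss : (size s)%:R / n%:R <= e / 2.
  apply: le_trans tail; apply: reciprocal_sum_ge => //.
    exact/filter_uniq/iota_uniq.
  by move=> k; rewrite mem_filter mem_index_iota => /andP[/set_mem].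
rewrite ler_pdivrMr ?ltr0n // in ss.
have big : N.+1%:R <= e / 2 * n%:R.
  rewrite -ler_pdivrMl ?divr_gt0 //; near: n; exact: nbhs_infty_ger.
apply: (@le_trans _ _ (N.+1 + size s)%:R); first by rewrite ler_nat.
by rewrite natrD; lra.
Unshelve. all: by end_near. 
Qed.

(** With x^-s written exp (- s ln x): since ln (k+1) - ln k >= 1/(k+1), the ratio of
    k^-delta to (k+1)^-delta is at least exp (delta/(k+1)) >= 1 + delta/(k+1), so
    their difference is at least delta (k+1)^-(1+delta). *)
Lemma expR_ln_telescope (R : realType) (delta : R) k :
  0 < delta -> (0 < k)%N ->
  expR (- ((1 + delta) * ln k.+1%:R)) <=
    - delta^-1 * expR (- (delta * ln k.+1%:R)) -
    (- delta^-1 * expR (- (delta * ln k%:R))).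
Proof.
move=> d0 k0.
have kp : (0 : R) < k%:R by rewrite ltr0n.
have k1p : (0 : R) < k.+1%:R by rewrite ltr0n.
have lnlt : k.+1%:R^-1 <= ln k.+1%:R - ln k%:R :> R.
  have : ln (k%:R / k.+1%:R) <= - k.+1%:R^-1 :> R.
    have -> : k%:R / k.+1%:R = 1 + - k.+1%:R^-1 :> R.
      by rewrite -natr1; field; apply: lt0r_neq0; lra.
    by apply: le_ln1Dx; rewrite ltrNr opprK invf_lt1 ?posrE // ltr1n ltnS.
  by rewrite ln_div ?posrE // lerNr opprB.
have -> : expR (- ((1 + delta) * ln k.+1%:R)) =
    expR (- (delta * ln k.+1%:R)) * k.+1%:R^-1.
  by rewrite mulrDl mul1r opprD expRD (expRN (ln _)) lnK ?posrE // mulrC.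
have -> : - (delta * ln k%:R) =
   - (delta * ln k.+1%:R) + delta * (ln k.+1%:R - ln k%:R) :> R by ring.
rewrite expRD.
set E := expR (- (delta * ln k.+1%:R)); set F := expR (delta * _).
have E0 : 0 < E by exact: expR_gt0.
have -> : - delta^-1 * E - - delta^-1 * (E * F) = E * (delta^-1 * (F - 1)) by ring.
rewrite ler_pM2l // mulrC ler_pdivlMr // lerBrDl.
apply: le_trans (expR_ge1Dx _); rewrite lerD2l mulrC ler_pM2l //.
Qed.

(** * Harmonic sum of one block *)

Lemma block_sum_le (R : realType) (g : nat -> nat) (I : set nat) U d k :
  adic_sequence g -> (0 < d)%N -> (forall i, (adic_quotient g i <= d)%N) ->
  (forall i, I i -> U i !=set0 /\ U i `<` `I_(adic_quotient g i)) ->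
  \sum_(g k <= n < g k.+1) reciprocal_on R (missing_digits_set g I U) n <=
    d%:R * (d.-1%:R / d%:R) ^+ counting_function I k.
Proof.
move=> hg d0 hd hU.
have gk : (0 < g k)%N by case: hg.
apply: (le_trans (reciprocal_sum_le (s := admissible_numbers g I U k.+1) _ gk _)).
  by move=> n nk An; exact: (missing_digits_admissible hg An nk).
have [_ up] := size_admissible_numbers_bounds k.+1 hg hd hU.
rewrite counting_functionE expr_div_n mulrA ler_pdivrMr ?ltr0n // mulrAC.
rewrite ler_pdivlMr ?exprn_gt0 ?ltr0n // -!natrX -!natrM ler_nat.
apply: (leq_trans up); rewrite -mulnA [leqRHS]mulnCA leq_mul2l.
by rewrite -(adic_quotientM k hg) leq_mul2r hd !orbT.
Qed.

(** The factor 2 comes from bounding the elements of g_k + B_k by 2 g_k. *)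
Lemma block_sum_ge (R : realType) (g : nat -> nat) (I : set nat) U d k :
  adic_sequence g -> (0 < d)%N -> (forall i, (adic_quotient g i <= d)%N) ->
  (forall i, I i -> U i !=set0 /\ U i `<` `I_(adic_quotient g i)) -> ~ I k ->
  (2 * d ^ counting_function I k)%:R^-1 <=
    \sum_(g k <= n < g k.+1) reciprocal_on R (missing_digits_set g I U) n.
Proof.
move=> hg d0 hd hU nIk.
have gk : (0 < g k)%N by case: hg.
have [lo _] := size_admissible_numbers_bounds k hg hd hU.
pose s := [seq (g k + b)%N | b <- admissible_numbers g I U k].
have g2 : (2 * g k <= g k.+1)%N.
  by rewrite -(adic_quotientM k hg) leq_mul2r adic_quotient_gt1 ?orbT.
apply: (@le_trans _ _ ((size s)%:R / (2 * g k)%:R)); last first.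
  have s_in n : n \in s -> (g k <= n < (2 * g k))%N /\ missing_digits_set g I U n.
    case/mapP => b bB ->; split; last exact: admissible_missing_digits.
    by have := admissible_numbers_lt hg bB; lia.
  apply: le_trans (reciprocal_sum_mono R _ (g k) g2).
  apply: (reciprocal_sum_ge R gk (leqnSn _)) s_in.
  by rewrite map_inj_uniq; [exact: admissible_numbers_uniq | exact: addnI].
rewrite size_map ler_pdivlMr ?ltr0n ?muln_gt0 // mulrC.
rewrite ler_pdivrMr ?ltr0n ?muln_gt0 ?expn_gt0 ?d0 // -natrM ler_nat.
rewrite counting_functionE /constrained_below big_nat_recr //=.
rewrite memNset // addn0 -/(constrained_below I k).
by rewrite mulnCA leq_mul.
Qed.

(** * Convergence and divergence *)

Lemma missing_digits_converges (R : realType) (g : nat -> nat) (I : set nat)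
    U d (delta : R) k0 :
  adic_sequence g -> (1 < d)%N -> (forall i, (adic_quotient g i <= d)%N) ->
  (forall i, I i -> U i !=set0 /\ U i `<` `I_(adic_quotient g i)) ->
  0 < delta -> (0 < k0)%N ->
  (forall k : nat, (k0 <= k)%N ->
     (counting_function I k)%:R >=
       (1 + delta) * ln k%:R / ln (d%:R / (d%:R - 1))) ->
  cvgn (harmonic_series_over R (missing_digits_set g I U)).
Proof.
move=> hg d1 hd hU delta0 k0_gt0 hI.
have d0 : (0 < d)%N by exact: ltnW.
have mono : {homo g : i j / (i <= j)%N} by move=> i j; exact: leq_adic.
set A := missing_digits_set g I U.
have pd : d.-1%:R = d%:R - 1 :> R by rewrite -subn1 natrB.
have dR : (1 : R) < d%:R by rewrite ltr1n.
have lnd : 0 < ln (d%:R / (d%:R - 1)) :> R.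
  by rewrite ln_gt0 // ltr_pdivlMr ?mul1r; lra.
pose f k : R := - delta^-1 * expR (- (delta * ln k%:R)).
have f0 k : f k <= 0 by rewrite /f mulNr oppr_le0 mulr_ge0 ?expR_ge0 // invr_ge0 ltW.
have block k : (k0 <= k)%N ->
    \sum_(g k.+1 <= n < g k.+2) reciprocal_on R A n <= d%:R * (f k.+1 - f k).
  move=> k0k; apply: (le_trans (block_sum_le R k.+1 hg d0 hd hU)).
  rewrite ler_pM2l ?ltr0n //.
  apply: (le_trans _ (expR_ln_telescope delta0 (leq_trans k0_gt0 k0k))).
  have -> : d.-1%:R / d%:R = expR (- ln (d%:R / (d%:R - 1))) :> R.
    rewrite expRN lnK ?posrE ?divr_gt0 ?invf_div ?pd //; lra.
  rewrite -expRM_natl mulrN ler_expR lerN2.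
  by rewrite -ler_pdivrMr // hI // (leq_trans k0k).
apply: nondecreasing_is_cvgn.
  by move=> a b ab; exact: reciprocal_sum_mono.
pose S := \sum_(0 <= n < g k0.+1) reciprocal_on R A n.
exists (S - d%:R * f k0) => _ [n _ <-].
apply: (le_trans (reciprocal_sum_mono R A 0 (adic_ge_index n hg))).
have le1 : (g n <= g (k0 + n).+1)%N by apply: mono; lia.
apply: (le_trans (reciprocal_sum_mono R A 0 le1)).
have le2 : (k0.+1 <= (k0 + n).+1)%N by rewrite ltnS leq_addr.
rewrite (big_cat_nat (leq0n _) (mono _ _ le2)) /= -/S lerD2l.
rewrite sum_blocks // big_add1 /=.
apply: (@le_trans _ _ (\sum_(k0 <= k < k0 + n) d%:R * (f k.+1 - f k))).
  by apply: ler_sum_nat => k /andP[k0k _]; exact: block.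
rewrite -mulr_sumr telescope_sumr ?leq_addr //.
by rewrite mulrBr lerBlDl subrr mulr_ge0_le0.
Qed.

(** The series is not Cauchy: blocks M to 2M - 1 contribute at least 1/8 for every
    large power M of 2. Indeed 2^I(2M) <= d^I(2M) <= 2M bounds I(2M) by
    log2 (2M) <= M/2, so at least M/2 of these blocks are unconstrained at their
    leading place, and each of those contributes at least 1/(4M). *)
Lemma missing_digits_diverges (R : realType) (g : nat -> nat) (I : set nat)
    U d k1 :
  adic_sequence g -> (1 < d)%N -> (forall i, (adic_quotient g i <= d)%N) ->
  (forall i, I i -> U i !=set0 /\ U i `<` `I_(adic_quotient g i)) ->
  (forall k : nat, (k1 <= k)%N -> (d ^ counting_function I k <= k)%N) ->
  ~ cvgn (harmonic_series_over R (missing_digits_set g I U)).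
Proof.
move=> hg d1 hd hU hI.
have d0 : (0 < d)%N by exact: ltnW.
have mono : {homo g : i j / (i <= j)%N} by move=> i j; exact: leq_adic.
set A := missing_digits_set g I U => cv.
(* Any value below 1/16 works: it is half of the gap 1/8. *)
have e0 : (0 : R) < 1 / 17 by lra.
have /cvgrPdist_le /(_ _ e0) [N _ HN] := cv.
(* 3 is the least exponent with 2 (m + 1) <= 2 ^ m. *)
pose m := (N + k1 + 3)%N; pose M := (2 ^ m)%N.
have mM : (m < M)%N by exact: ltn_expl.
have gap : 8^-1 <= \sum_(g M <= n < g M.*2) reciprocal_on R A n.
  have cM : (counting_function I M.*2 <= m.+1)%N.
    have : (2 ^ counting_function I M.*2 <= 2 ^ m.+1)%N.
      rewrite expnS mul2n -/M.
      apply: leq_trans (hI _ _); last by lia.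
      by case: (counting_function _ _) => // j; rewrite leq_exp2r.
    by rewrite leq_exp2l.
  have m4 : (2 * m.+1 <= M)%N.
    rewrite /M /m addn3; elim: (N + k1)%N => // j; rewrite [(2 ^ j.+4)%N]expnS; lia.
  rewrite sum_blocks ?leq_double //; last by lia.
  apply: (@le_trans _ _ (\sum_(M <= k < M.*2) (k \notin I)%:R / (4 * M)%:R)).
    rewrite -mulr_suml -natr_sum.
    have : (M <= \sum_(M <= k < M.*2) (k \notin I) + \sum_(M <= k < M.*2) (k \in I))%N.
      rewrite -big_split /=.
      rewrite (eq_bigr (fun=> 1%N)) => [|k _]; last by case: (k \in I).
      by rewrite sum_nat_const_nat; lia.
    have : (\sum_(M <= k < M.*2) (k \in I) <= counting_function I M.*2)%N.
      rewrite counting_functionE /constrained_below.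
      rewrite (big_cat_nat (leq0n M)) //=; last by lia.
      by rewrite big_nat_recr /= ?addnA; lia.
    move=> h1 h2.
    rewrite ler_pdivlMr ?ltr0n; last by lia.
    rewrite mulrC ler_pdivrMr // -natrM ler_nat; lia.
  apply: ler_sum_nat => k /andP[Mk k2M].
  case: (boolP (k \in I)) => [_|/negP kI].
    by rewrite mul0r; apply: sumr_ge0 => n _; exact: reciprocal_on_ge0.
  apply: le_trans (block_sum_ge R hg d0 hd hU _); last first.
    by move=> Ik; apply/kI/mem_set.
  rewrite mul1r lef_pV2 ?posrE ?ltr0n ?muln_gt0 ?expn_gt0 ?d0 //.
  by rewrite ler_nat; have := hI k; lia.
have NM : (N <= g M)%N by apply: leq_trans (adic_ge_index _ hg); lia.
have MM : (g M <= g M.*2)%N by apply: mono; lia.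
have /= := HN (g M) NM; have /= := HN (g M.*2) (leq_trans NM MM).
have := sub_series_geq (reciprocal_on R A) MM.
rewrite !ler_distl /harmonic_series_over -/(reciprocal_on R A).
move: gap; set x := bigop.body _ _ _ => gap.
by rewrite /reciprocal_on => ? ? ?; lra.
Qed.

Theorem theorem1 (R : realType) (g : nat -> nat) (hg : adic_sequence g)
    (d : nat) (hd : (2 <= d)%N) (hbound : forall i, (adic_quotient g i <= d)%N)
    (I : set nat) (U : nat -> set nat)
    (hU : forall i, I i -> U i !=set0 /\ U i `<` `I_(adic_quotient g i)) :
  let A := missing_digits_set g I U in
  ((exists delta : R, 0 < delta /\
      exists k0 : nat, (0 < k0)%N /\
        forall k : nat, (k0 <= k)%N ->
          (counting_function I k)%:R >=
            (1 + delta) * ln k%:R / ln (d%:R / (d%:R - 1))) ->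
    asymptotic_density_zero R A /\ cvgn (harmonic_series_over R A)) /\
  ((exists delta : R, 0 < delta /\
      exists k1 : nat, (0 < k1)%N /\
        forall k : nat, (k1 <= k)%N ->
          (counting_function I k)%:R <= (1 - delta) * ln k%:R / ln d%:R) ->
    ~ cvgn (harmonic_series_over R A)).
Proof.
move=> A; split.
  case=> delta [delta0 [k0 [k0_gt0 hI]]].
  have cv : cvgn (harmonic_series_over R A).
    exact: missing_digits_converges hI.
  by split=> //; exact: harmonic_cvg_density_zero.
case=> delta [delta0 [k1 [k1_gt0 hI]]].
apply: (missing_digits_diverges (d := d) (k1 := k1)) => // k k1k.
have k_gt0 : (0 < k)%N by exact: leq_trans k1k.
have lnd : 0 < ln d%:R :> R by rewrite ln_gt0 // ltr1n.
have lnk : 0 <= ln k%:R :> R by rewrite ln_ge0 // ler1n.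
have dp : d%:R \is @Num.pos R by rewrite posrE ltr0n ltnW.
have kp : k%:R \is @Num.pos R by rewrite posrE ltr0n.
rewrite -(ler_nat R) natrX -[X in X ^+ _](lnK dp) -[leRHS](lnK kp).
rewrite -expRM_natl ler_expR -ler_pdivlMr //.
apply: (le_trans (hI k k1k)).
by rewrite ler_pM2r ?invr_gt0 // ler_piMl // gerBl ltW.
Qed.
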